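(* Let $p$ be a prime, $k\in\mathbb{N}$, $l\in[k]$ and $\mathsf{u}=(\mathsf{u}_1,\dots,\mathsf{u}_k)\in\{0,1\}^k$. Then $$\Gamma_{l;k}(\mathsf{u}) = p^k\cdot C_l(\mathsf{u}).$$
   Context: $[m]=\{1,\dots,m\}$; $\mathfrak{S}_n$ is the symmetric group on $[n]$; characters are complex. Sylow subgroups: $P_p\le\mathfrak{S}_p$ is cyclic of order $p$, and for $k\ge 2$, $P_{p^k}=P_{p^{k-1}}\wr P_p=(P_{p^{k-1}})^{\times p}\rtimes P_p\le \mathfrak{S}_{p^k}$ (imprimitive action: the $p$ base factors act on $p$ disjoint blocks of size $p^{k-1}$ and $P_p$ permutes the blocks); this is a Sylow $p$-subgroup of $\mathfrak{S}_{p^k}$. Linear characters: for linear characters $\phi$ of $P_{p^{k-1}}$ and $\psi$ of $P_p$, $\mathcal{X}(\phi;\psi)$ is the linear character $(g_1,\dots,g_p;h)\mapsto\phi(g_1)\cdots\phi(g_p)\psi(h)$ of $P_{p^k}$. Recursively $\mathcal{X}(\phi_1)=\phi_1$ and $\mathcal{X}(\phi_1,\dots,\phi_k)=\mathcal{X}(\mathcal{X}(\phi_1,\dots,\phi_{k-1});\phi_k)$, for linear characters $\phi_i$ of $P_p$; every linear character of $P_{p^k}$ is uniquely of this form. For $\mathsf{u}\in\{0,1\}^k$, $\phi(\mathsf{u})$ denotes any linear character $\mathcal{X}(\psi_1,\dots,\psi_k)$ of $P_{p^k}$ such that, for each $j$, $\mathsf{u}_j=1$ if and only if $\psi_j$ is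 trivial (the claim holds for every such choice). $\Gamma_{l;k}(\mathsf{u}):=\sum_x \phi(\mathsf{u})(x)$, where $x$ runs over all elements of $P_{p^k}$ consisting of one cycle of length $p^l$ and otherwise fixed points. $C_l(\mathsf{u}) := p^{\frac{p^l-1}{p-1}-2l}\cdot\prod_{m=1}^l(p\mathsf{u}_m-1)$. *)

(* Defs.v *)
From HB Require Import structures.
From mathcomp Require Import all_boot all_order all_algebra.
From mathcomp Require Import all_fingroup all_solvable all_field all_character.

Set Implicit Arguments.
Unset Strict Implicit.
Unset Printing Implicit Defensive.

Import Order.TTheory GRing.Theory Num.Theory.
Local Open Scope ring_scope.

Lemma linear_char_of_morph (gT : finGroupType) (G : {group gT})
    (f : gT -> algC) :
    f 1%g = 1 -> {in G &, {morph f : x y / (x * y)%g >-> x * y}} ->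
  exists2 chi : 'CF(G), chi \is a linear_char & {in G, chi =1 f}.
Proof.
move=> f1 fM; pose r x : 'M[algC]_1 := (f x)%:M.
have rP : mx_repr G r.
  by split=> [|x y Gx Gy]; rewrite /r ?f1 // fM // scalar_mxM.
have E : {in G, cfRepr (MxRepresentation rP) =1 f}.
  by move=> x Gx; rewrite cfunE Gx mulr1n /= mxtrace_scalar mulr1n.
exists (cfRepr (MxRepresentation rP)) => //.
by rewrite qualifE /= cfRepr_char E // f1 /=.
Qed.

Section Wreath.

Variables p n : nat.

(* The points of 'I_(p * n) are split into p blocks of size n: the point of
   index j of the block i is mxvec_index i j, i.e., i * n + j. *)
Definition unblock (k : 'I_(p * n)) : 'I_p * 'I_n :=
  enum_val (cast_ord (esym (mxvec_cast p n)) k).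

Lemma unblockK : cancel unblock (uncurry (@mxvec_index p n)).
Proof.
move=> k; rewrite /unblock; set ij := enum_val _.
have -> : uncurry (@mxvec_index p n) ij = mxvec_index ij.1 ij.2 by case: ij.
rewrite /mxvec_index -surjective_pairing /ij enum_valK.
exact: val_inj.
Qed.

Lemma mxvec_indexK i j : unblock (mxvec_index i j) = (i, j).
Proof. by rewrite /unblock /mxvec_index cast_ordK enum_rankK. Qed.

Definition wr_fun (g : {ffun 'I_p -> 'S_n}) (h : 'S_p) (k : 'I_(p * n)) :=
  mxvec_index (h (unblock k).1) (g (unblock k).1 (unblock k).2).

Lemma wr_fun_inj g h : injective (wr_fun g h).
Proof.
move=> k1 k2 /(congr1 unblock); rewrite !mxvec_indexK => -[/perm_inj e1].
rewrite e1 => /perm_inj e2; apply: (can_inj unblockK).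
by rewrite [unblock k1]surjective_pairing e1 e2 -surjective_pairing.
Qed.

(* The element (g_1, ..., g_p; h) of the wreath product. Since s * t stands for
   "s, then t" on permutations, this is the product of the base element
   (g_1, ..., g_p), where g_i acts on the i-th block, by the permutation h of
   the blocks. *)
Definition wr g h : 'S_(p * n) := perm (@wr_fun_inj g h).

Lemma wrE g h i j : wr g h (mxvec_index i j) = mxvec_index (h i) (g i j).
Proof. by rewrite permE /wr_fun mxvec_indexK. Qed.

Lemma eq_on_blocks (s t : 'S_(p * n)) :
  (forall i j, s (mxvec_index i j) = t (mxvec_index i j)) -> s = t.
Proof. by move=> e; apply/permP => k; case/mxvec_indexP: k. Qed.

Lemma wr1 : wr [ffun=> 1%g] 1%g = 1%g.
Proof. by apply: eq_on_blocks => i j; rewrite wrE ffunE !perm1. Qed.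

Lemma wrM g1 h1 g2 h2 :
  (wr g1 h1 * wr g2 h2)%g = wr [ffun i => (g1 i * g2 (h1 i))%g] (h1 * h2)%g.
Proof. by apply: eq_on_blocks => i j; rewrite permM !wrE ffunE !permM. Qed.

Lemma wr_inj g1 h1 g2 h2 :
  (0 < n)%N -> wr g1 h1 = wr g2 h2 -> g1 = g2 /\ h1 = h2.
Proof.
move=> n_gt0 e.
have eij i j : (h1 i, g1 i j) = (h2 i, g2 i j).
  by rewrite -!mxvec_indexK -!wrE e.
split; last by apply/permP => i; have [] := eij i (Ordinal n_gt0).
by apply/ffunP => i; apply/permP => j; have [] := eij i j.
Qed.

Section Groups.

Variables (G : {group 'S_n}) (H : {group 'S_p}).

Definition wreath : {set 'S_(p * n)} :=
  [set wr g h | g in ffun_on (mem G), h in H].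

Lemma wreathP s :
  reflect (exists (g : {ffun 'I_p -> 'S_n}) h, [/\ forall i, g i \in G, h \in H & s = wr g h])
          (s \in wreath).
Proof.
apply: (iffP imset2P) => [[g h /ffun_onP Gg Hh ->] | [g [h [Gg Hh ->]]]].
  by exists g, h.
by exists g h => //; apply/ffun_onP.
Qed.

Lemma wreath_group_set : group_set wreath.
Proof.
apply/group_setP; split=> [|s t].
  by apply/wreathP; exists [ffun=> 1%g], 1%g; split=> // [i|]; rewrite ?ffunE ?wr1.
move=> /wreathP[g1 [h1 [Gg1 Hh1 ->]]] /wreathP[g2 [h2 [Gg2 Hh2 ->]]].
rewrite wrM; apply/wreathP; do 2!eexists; split; last by [].
  by move=> i; rewrite ffunE groupM.
exact: groupM.
Qed.
Canonical wreath_group := Group wreath_group_set.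

(* When 0 < n the pair (g, h) such that s = wr g h is unique. The default value
   0 of insubd is not used when phi and psi are linear characters, see wr_charE
   below. *)
Definition wr_char (phi : 'CF(G)) (psi : 'CF(H)) : 'CF(wreath) :=
  insubd (0 : 'CF(wreath))
    [ffun s => if [pick gh : {ffun 'I_p -> 'S_n} * 'S_p
                      | (gh.1 \in ffun_on (mem G)) && (gh.2 \in H)
                        && (s == wr gh.1 gh.2)] is Some gh
               then (\prod_i phi (gh.1 i)) * psi gh.2 else 0].

Variables (phi : 'CF(G)) (psi : 'CF(H)).
Hypotheses (n_gt0 : (0 < n)%N).
Hypotheses (lin_phi : phi \is a linear_char) (lin_psi : psi \is a linear_char).

Lemma wr_char_spec :
  wr_char phi psi \is a linear_char /\
  forall (g : {ffun 'I_p -> 'S_n}) h, (forall i, g i \in G) -> h \in H ->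
    wr_char phi psi (wr g h) = (\prod_i phi (g i)) * psi h.
Proof.
pose F (s : 'S_(p * n)) :=
  if [pick gh : {ffun 'I_p -> 'S_n} * 'S_p
        | (gh.1 \in ffun_on (mem G)) && (gh.2 \in H)
          && (s == wr gh.1 gh.2)] is Some gh
  then (\prod_i phi (gh.1 i)) * psi gh.2 else 0.
have FE (g : {ffun 'I_p -> 'S_n}) h : (forall i, g i \in G) -> h \in H ->
    F (wr g h) = (\prod_i phi (g i)) * psi h.
  move=> Gg Hh; rewrite /F; case: pickP => [[g' h'] /= | /(_ (g, h)) /=].
    by case/andP=> _ /eqP/(wr_inj n_gt0)[-> ->].
  by rewrite Hh eqxx !andbT => /negP[]; apply/ffun_onP.
have F0 s : s \notin wreath -> F s = 0.
  move=> nWs; rewrite /F; case: pickP => // -[g h] /=.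
  case/andP=> /andP[/ffun_onP Gg Hh] /eqP es; case/negP: nWs.
  by apply/wreathP; exists g, h.
have F1 : F 1%g = 1.
  rewrite -wr1 FE ?(lin_char1 lin_psi) ?mulr1 // => [|i]; last by rewrite ffunE.
  by apply: big1 => i _; rewrite ffunE lin_char1.
have FM : {in wreath_group &, {morph F : x y / (x * y)%g >-> x * y}}.
  move=> s t /wreathP[g1 [h1 [Gg1 Hh1 ->]]] /wreathP[g2 [h2 [Gg2 Hh2 ->]]].
  rewrite wrM !FE ?groupM // => [|i]; last by rewrite ffunE groupM.
  rewrite (lin_charM lin_psi) // mulrACA; congr (_ * _).
  rewrite [X in _ = _ * X](reindex_inj (@perm_inj _ h1)) -big_split /=.
  by apply: eq_bigr => i _; rewrite ffunE (lin_charM lin_phi).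
have [chi lin_chi chiE] := linear_char_of_morph F1 FM.
have -> : wr_char phi psi = chi.
  have eF : [ffun s => F s] = val chi.
    apply/ffunP=> s; rewrite ffunE -[RHS]/(chi s).
    by have [/chiE // | nWs] := boolP (s \in wreath_group); rewrite F0 ?cfun0.
  by apply: val_inj; rewrite /wr_char -/F val_insubd eF (valP chi).
by split=> // g h Gg Hh; rewrite chiE ?FE //; apply/wreathP; exists g, h.
Qed.

Lemma wr_char_lin : wr_char phi psi \is a linear_char.
Proof. by case: wr_char_spec. Qed.

Lemma wr_charE (g : {ffun 'I_p -> 'S_n}) h : (forall i, g i \in G) -> h \in H ->
  wr_char phi psi (wr g h) = (\prod_i phi (g i)) * psi h.
Proof. by case: wr_char_spec => _; apply. Qed.

End Groups.

End Wreath.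

Section Sylow.

(* C is the subgroup P_p of 'S_p. *)
Variables (p : nat) (C : {group 'S_p}).

(* P_(p^k); the types use that p ^ 1 is convertible to p and p ^ k.+2 to
   p * p ^ k.+1. The trivial group for k = 0 is only a convention. *)
Fixpoint sylS (k : nat) : {group 'S_(p ^ k)} :=
  if k is k'.+1 then
    match k' return {group 'S_(p ^ k')} -> {group 'S_(p ^ k'.+1)} with
    | 0 => fun _ => C
    | m.+1 => fun P => wreath_group P C
    end (sylS k')
  else 1%G.

(* X(psi_1, ..., psi_k), with psi_(i + 1) written psi i. *)
Fixpoint sylX (k : nat) : ('I_k -> 'CF(C)) -> 'CF(sylS k) :=
  if k is k'.+1 then
    match k' return (('I_k' -> 'CF(C)) -> 'CF(sylS k')) ->
                    ('I_k'.+1 -> 'CF(C)) -> 'CF(sylS k'.+1) with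
    | 0 => fun _ psi => psi ord0
    | m.+1 => fun X psi =>
        wr_char (X (fun i => psi (widen_ord (leqnSn m.+1) i))) (psi ord_max)
    end (@sylX k')
  else fun _ => 1.

Lemma sylX_lin k (psi : 'I_k -> 'CF(C)) :
  (0 < p)%N -> (forall i, psi i \is a linear_char) ->
  sylX psi \is a linear_char.
Proof.
move=> p_gt0; elim: k psi => [|[|k] IHk] psi lin_psi; first exact: cfun1_lin_char.
  exact: lin_psi.
have q_gt0 : (0 < p ^ k.+1)%N by rewrite expn_gt0 p_gt0.
by apply: wr_char_lin => //; apply: IHk.
Qed.

(* phi is one of the linear characters denoted phi(u). *)
Definition has_shape (k : nat) (u : {ffun 'I_k -> bool}) (phi : 'CF(sylS k)) :=
  exists psi : 'I_k -> 'CF(C),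
    [/\ forall i, psi i \is a linear_char,
        forall i, u i <-> psi i = 1
      & phi = sylX psi].

End Sylow.

(* s consists of one cycle of length q and otherwise fixed points. *)
Definition one_cycle (T : finType) (q : nat) (s : {perm T}) : bool :=
  [exists A in porbits s,
     (#|A| == q) && [forall B in porbits s, (B != A) ==> (#|B| == 1%N)]].

Definition Gamma (p : nat) (C : {group 'S_p}) (l k : nat)
    (phi : 'CF(sylS C k)) : algC :=
  \sum_(x in sylS C k | one_cycle (p ^ l) x) phi x.

(* The exponent of p is an integer, negative e.g. for l = 1; the natural number
   division by p - 1 is exact. The factor of index m in the usual 1-based
   numbering is the one of index i = m - 1. *)
Definition Cconst (p k l : nat) (u : {ffun 'I_k -> bool}) : algC :=
  p%:R ^ (((p ^ l - 1) %/ (p - 1))%:Z - (2 * l)%:Z)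
  * \prod_(i < k | (i < l)%N) (p%:R * (u i)%:R - 1).

(* Main.v *)
(* An element of P_(p^(k+1)) is a pair (g; h). If h = 1, it is a single
   p^l-cycle exactly when one g_i is such a cycle and the others are trivial,
   so these elements contribute p * Gamma_(l;k). If h <> 1, then h is a p-cycle
   of the blocks without fixed points, so (g; h) can only be a full cycle, and
   it is one exactly when the product of the g_i along the h-orbit is a full
   cycle of P_(p^k); as each product arises from |P_(p^k)|^(p-1) choices of g,
   these elements contribute
   |P_(p^k)|^(p-1) * (sum of psi_(k+1) over h <> 1) * Gamma_(k;k). *)

Require Import Defs.
From mathcomp Require Import zify.
From mathcomp Require Import all_boot all_order all_algebra.
From mathcomp Require Import all_fingroup all_solvable all_field all_character.

Set Implicit Arguments.
Unset Strict Implicit.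
Unset Printing Implicit Defensive.

Import Order.TTheory GRing.Theory Num.Theory.
Local Open Scope ring_scope.

(** * Permutations with a single nontrivial cycle *)

Lemma card_porbit_eq1 (T : finType) (s : {perm T}) x :
  (#|porbit s x| == 1%N) = (s x == x).
Proof.
apply/eqP/eqP=> [/eqP/cards1P[z oz] | sx].
  have := mem_porbit s 1 x; have := porbit_id s x.
  by rewrite oz !inE expg1 => /eqP-> /eqP.
apply/eqP/cards1P; exists x; apply/setP=> z; rewrite inE.
apply/porbitP/eqP=> [[i ->] | ->]; last by exists 0; rewrite perm1.
by elim: i => [|i IHi]; rewrite ?perm1 // expgSr permM IHi.
Qed.

Lemma one_cycleP (T : finType) (q : nat) (s : {perm T}) :
  reflect (exists2 x, #|porbit s x| = q & forall y, y \notin porbit s x -> s y = y)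
          (one_cycle q s).
Proof.
apply: (iffP exists_inP) => [[_ /imsetP[x _ ->] /andP[/eqP ox /forall_inP fx]] | [x ox fx]].
  exists x => // y nxy; apply/eqP; rewrite -card_porbit_eq1.
  have /fx/implyP-> // : porbit s y \in porbits s by apply: imset_f.
  by apply: contraNneq nxy => <-; apply: porbit_id.
exists (porbit s x); first exact: imset_f.
rewrite ox eqxx; apply/forall_inP=> _ /imsetP[y _ ->]; apply/implyP.
by rewrite card_porbit_eq1 eq_porbit_mem => /fx->.
Qed.

Lemma one_cycle_fullP (T : finType) (s : {perm T}) :
  reflect (exists x, porbit s x = setT) (one_cycle #|T| s).
Proof.
apply: (iffP (one_cycleP _ _)) => [[x ox _] | [x ox]]; exists x.
- by apply/eqP; rewrite eqEcard subsetT cardsT ox leqnn.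
- by rewrite ox cardsT.
by move=> y; rewrite ox inE.
Qed.

Lemma one_cycle_le (T : finType) q (s : {perm T}) : one_cycle q s -> (q <= #|T|)%N.
Proof. by case/one_cycleP=> x <- _; apply: max_card. Qed.

Lemma one_cycle1 (T : finType) q : (1 < q)%N -> one_cycle q (1 : {perm T})%g = false.
Proof.
move=> q_gt1; apply/one_cycleP=> -[x oq _].
have /eqP o1 : #|porbit (1 : {perm T})%g x| == 1%N by rewrite card_porbit_eq1 perm1.
by rewrite -oq o1 in q_gt1.
Qed.

(** * Cycles of elements of a wreath product *)

Section WreathCycles.

Variables p n : nat.
Implicit Types (g : {ffun 'I_p -> 'S_n}) (h : 'S_p).

Lemma mxvec_index_inj (i i' : 'I_p) (j j' : 'I_n) :
  mxvec_index i j = mxvec_index i' j' -> i = i' /\ j = j'.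
Proof. by move/(congr1 (@unblock p n)); rewrite !mxvec_indexK => -[]. Qed.

Lemma wrX g h t i j :
  (wr g h ^+ t)%g (mxvec_index i j) =
  mxvec_index ((h ^+ t)%g i) ((\prod_(s < t) g ((h ^+ s)%g i))%g j).
Proof.
elim: t => [|t IHt]; first by rewrite big_ord0 !perm1.
by rewrite expgSr permM IHt wrE big_ord_recr !permM expgSr permM.
Qed.

Lemma porbit_wr1 g i j :
  porbit (wr g 1) (mxvec_index i j) = mxvec_index i @: porbit (g i) j.
Proof.
have wrXi t : (wr g 1 ^+ t)%g (mxvec_index i j) = mxvec_index i ((g i ^+ t)%g j).
  rewrite wrX expg1n perm1; congr (mxvec_index _ (fun_of_perm _ _)).
  rewrite (eq_bigr (fun=> g i)) => [|s _]; last by rewrite expg1n perm1.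
  by rewrite prodg_const card_ord.
apply/setP=> y; apply/porbitP/imsetP=> [[t ->] | [_ /porbitP[t ->] ->]].
  by exists ((g i ^+ t)%g j); rewrite ?mem_porbit.
by exists t.
Qed.

(** Every block is stable under [wr g 1], so the orbit of length [q] lies in one block; all points
    outside it are fixed, which makes the other components trivial. *)
Lemma one_cycle_wr1 q g :
  one_cycle q (wr g 1) =
  [exists i, one_cycle q (g i) && [forall j, (j != i) ==> (g j == 1%g)]].
Proof.
have card_i i (A : {set 'I_n}) : #|@mxvec_index p n i @: A| = #|A|.
  by rewrite card_imset // => j j' /mxvec_index_inj[].
apply/one_cycleP/existsP=> [[x] | [i /andP[/one_cycleP[j oq fj] /forall_inP g1]]].
  case/mxvec_indexP: x => i j; rewrite porbit_wr1 card_i => oq fx; exists i.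
  apply/andP; split.
    apply/one_cycleP; exists j => // y ny.
    have /fx : mxvec_index i y \notin @mxvec_index p n i @: porbit (g i) j.
      by apply: contra ny => /imsetP[z oz /mxvec_index_inj[_ ->]].
    by rewrite wrE => /mxvec_index_inj[].
  apply/forall_inP=> a nai; apply/eqP/permP=> b; rewrite perm1.
  have /fx : mxvec_index a b \notin @mxvec_index p n i @: porbit (g i) j.
    by apply: contra nai => /imsetP[z oz /mxvec_index_inj[-> _]].
  by rewrite wrE => /mxvec_index_inj[].
exists (mxvec_index i j); rewrite porbit_wr1 ?card_i // => y.
case/mxvec_indexP: y => a b nab; rewrite wrE perm1; congr mxvec_index.
have [eai | /g1/eqP->] := eqVneq a i; last by rewrite perm1.
by move: nab; rewrite eai => nb; apply: fj; apply: contra nb; apply: imset_f.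
Qed.

(* The p-th power of [wr g h] stabilizes the block of i, where it acts as the
   product of the g's along the h-orbit of i. *)
Lemma one_cycle_wr_transitive q g h i :
    (1 < p)%N -> #[h]%g = p -> (forall a, porbit h a = setT) ->
  one_cycle q (wr g h) =
  (q == p * n)%N && one_cycle n (\prod_(t < p) g ((h ^+ t)%g i))%g.
Proof.
move=> p_gt1 oh trh; set N := (\prod_(t < p) _)%g.
have p_gt0 : (0 < p)%N := ltnW p_gt1.
have hp : (h ^+ p = 1)%g by have := expg_order h; rewrite oh.
have wrXp : (forall m j, (wr g h ^+ (m * p))%g (mxvec_index i j)
                  = mxvec_index i ((N ^+ m)%g j)).
  elim=> [|m IHm] j; first by rewrite !perm1.
  rewrite mulSn addnC expgD permM IHm wrX hp perm1 -/N; congr mxvec_index.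
  by rewrite -permM -expgSr.
have hfix a : h a != a.
  by rewrite -card_porbit_eq1 trh cardsT card_ord gtn_eqF.
(* A power of [h] that fixes [i] commutes with [h], hence fixes the whole orbit of [i], which is
   everything. *)
have per t : (h ^+ t)%g i = i -> (p %| t)%N.
  move=> hti; rewrite -oh order_dvdn; apply/eqP/permP=> a.
  have /porbitP[b ->] : a \in porbit h i by rewrite trh.
  by rewrite perm1 -!permM -expgD addnC expgD permM hti.
(* Since [h] moves every block, [wr g h] has no fixed point, so its only cycle must fill all [p * n]
   points. *)
transitivity ((q == p * n)%N && one_cycle (p * n)%N (wr g h)).
  have [-> // | /eqP ne] := eqVneq q (p * n)%N.
  apply/idP=> oq; apply: ne.
  case/one_cycleP: oq => x <- fx; rewrite -[RHS]card_ord -cardsT.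
  apply: eq_card => y; rewrite inE; apply: contraT => /fx.
  case/mxvec_indexP: y => a b; rewrite wrE => /mxvec_index_inj[ha _].
  by have := hfix a; rewrite ha eqxx.
congr (_ && _); rewrite -[X in one_cycle X (wr g h)]card_ord.
rewrite -[X in one_cycle X N]card_ord.
apply/one_cycle_fullP/one_cycle_fullP=> [[x ox] | [j oj]].
  (* The orbit of [x] is everything, so the base point may be moved into block [i]; only the block
     of [x] is discarded. *)
  pose j := (unblock x).2.
  have {ox}ox : porbit (wr g h) (mxvec_index i j) = setT.
    by rewrite -ox; apply/eqP; rewrite eq_porbit_mem ox.
  exists j; apply/setP=> j'; rewrite inE.
  have /porbitP[t] : mxvec_index i j' \in porbit (wr g h) (mxvec_index i j).
    by rewrite ox inE.
  move=> e; have /dvdnP[m et] : (p %| t)%N.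
    by apply: per; move: e; rewrite wrX => /mxvec_index_inj[/esym].
  by move: e; rewrite et wrXp => /mxvec_index_inj[_ ->]; apply: mem_porbit.
exists (mxvec_index i j); apply/setP=> y; rewrite inE.
case/mxvec_indexP: y => a b.
have /porbitP[t ea] : a \in porbit h i by rewrite trh inE.
(* The point of block [i] that [t] further steps carry to [b] in block [a]; powers of [N] reach it
   from [j]. *)
pose b' := (\prod_(s < t) g ((h ^+ s)%g i))^-1%g b.
have /porbitP[m eb] : b' \in porbit N j by rewrite oj inE.
apply/porbitP; exists (m * p + t)%N.
by rewrite expgD permM wrXp wrX -ea -eb /b' permKV.
Qed.

End WreathCycles.

(** * Sums of linear characters and of functions of a product *)

Lemma sum_lin_char (gT : finGroupType) (G : {group gT}) (psi : 'CF(G)) :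
  psi \is a linear_char -> \sum_(x in G) psi x = (psi == 1)%:R * #|G|%:R.
Proof.
move=> lin_psi; have := cfdot_irr (cfIirr psi) 0.
rewrite cfIirrE ?lin_char_irr // irr0.
have -> : (cfIirr psi == 0) = (psi == 1).
  by rewrite -(inj_eq irr_inj) cfIirrE ?lin_char_irr // irr0.
rewrite cfdotE => <-; rewrite mulrAC mulVf ?neq0CG // mul1r.
by apply: eq_bigr => x Gx; rewrite cfun1E Gx rmorph1 mulr1.
Qed.

Lemma sum_lin_char_neq1 (gT : finGroupType) (G : {group gT}) (psi : 'CF(G)) :
  psi \is a linear_char ->
  \sum_(x in G | x != 1%g) psi x = #|G|%:R * (psi == 1)%:R - 1.
Proof.
move=> lin_psi; rewrite mulrC -(sum_lin_char lin_psi).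
by rewrite [in RHS](bigD1 1%g) //= (lin_char1 lin_psi) addrAC subrr add0r.
Qed.

(* Averaging over the left translates of the first factor. *)
Lemma sum_ffun_on_prod (gT : finGroupType) (G : {group gT}) (F : gT -> algC)
    (m : nat) (r : 'I_m -> 'I_m) :
  (0 < m)%N -> injective r ->
  \sum_(g : {ffun 'I_m -> gT} | g \in ffun_on (mem G)) F (\prod_(t < m) g (r t))%g
    = #|G|%:R ^+ m.-1 * \sum_(x in G) F x.
Proof.
case: m r => // m r _ r_inj; set S := LHS.
pose N (g : {ffun 'I_m.+1 -> gT}) := (\prod_(t < m.+1) g (r t))%g.
(* Only the coordinate [r ord0] is translated; as [r] is injective, it occurs once in [N g], in
   first position, so [N] is multiplied by [z] on the left. *)
pose T z (g : {ffun 'I_m.+1 -> gT}) :=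
  [ffun i => if i == r ord0 then (z * g i)%g else g i].
have TK z : cancel (T z) (T z^-1%g).
  by move=> g; apply/ffunP=> i; rewrite !ffunE; case: (i == _); rewrite ?mulKg.
have NT z g : N (T z g) = (z * N g)%g.
  rewrite /N !big_ord_recl ffunE eqxx -mulgA; congr (_ * (_ * _))%g.
  by apply: eq_bigr => i _; rewrite ffunE (inj_eq r_inj).
have GT z g : z \in G -> (T z g \in ffun_on (mem G)) = (g \in ffun_on (mem G)).
  move=> Gz; apply/ffun_onP/ffun_onP=> Gg i; have := Gg i; rewrite ffunE.
    by case: ifP => // _; rewrite groupMl.
  by case: ifP => // _; rewrite groupMl.
have ST z : z \in G ->
    S = \sum_(g : {ffun 'I_m.+1 -> gT} | g \in ffun_on (mem G)) F (z * N g)%g.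
  move=> Gz; rewrite /S (reindex_inj (can_inj (TK z))).
  by apply: eq_big => g; rewrite ?GT // -/(N _) NT.
have GN g : g \in ffun_on (mem G) -> N g \in G.
  by move=> /ffun_onP Gg; apply: group_prod => t _; apply: Gg.
(* After multiplication by the order of [G], the left side is a double sum over [z] and [g]. For
   fixed [g], right translation by [N g] makes the sum over [z] independent of [g]. *)
apply: (mulfI (neq0CG G)); rewrite mulrA -exprS.
rewrite mulr_natl -sumr_const (eq_bigr _ ST) exchange_big /=.
rewrite (eq_bigr (fun=> \sum_(x in G) F x)) => [|g /GN GNg]; last first.
  by rewrite [RHS](reindex_inj (mulIg (N g))); apply: eq_bigl => x; rewrite groupMr.
by rewrite sumr_const card_ffun_on card_ord -natrX mulr_natl.
Qed.

(** * The action of a group of prime order p on p points *)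

Section PrimeOrder.

Variables (p : nat) (C : {group 'S_p}).
Hypotheses (p_pr : prime p) (oC : #|C| = p).

Lemma order_prime_group h : h \in C -> h != 1%g -> #[h]%g = p.
Proof.
move=> Ch nh1; have /primeP[_ /(_ #[h]%g)] := p_pr.
rewrite order_eq1 (negPf nh1) => /(_ _)/eqP-> //.
by rewrite -[X in (_ %| X)%N]oC order_dvdG.
Qed.

(** Orbit lengths divide p, so the orbit of any point moved by [h] has p elements and leaves room
    for no other. *)
Lemma porbit_prime_group h a : h \in C -> h != 1%g -> porbit h a = setT.
Proof.
move=> Ch nh1; have oh := order_prime_group Ch nh1.
have dv b : (#|porbit h b| == 1%N) || (#|porbit h b| == p).
  have /primeP[_ ->] // := p_pr.
  by have := dvdn_orbit 'P <[h]>%G b; rewrite -porbitE -[#|<[h]>%G|]/(#[h]%g) oh.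
have [b nfb] : exists b, h b != b.
  apply/existsP; apply: contraNT nh1 => /existsPn fh.
  by apply/eqP/permP=> b; rewrite perm1; apply/eqP/negPn/fh.
have ob : porbit h b = setT.
  apply/eqP; rewrite eqEcard subsetT cardsT card_ord.
  by have := dv b; rewrite card_porbit_eq1 (negPf nfb) => /eqP->; rewrite leqnn.
by rewrite -ob; apply/eqP; rewrite eq_porbit_mem ob inE.
Qed.

(** Used to index the p blocks by the exponents [t < p], in the order in which [h] visits them. *)
Lemma expg_prime_group_inj h a :
  h \in C -> h != 1%g -> injective (fun t : 'I_p => (h ^+ t)%g a).
Proof.
move=> Ch nh1 t s; have := uniq_traject_porbit h a.
rewrite porbit_prime_group // cardsT card_ord => U.
rewrite !permX -!(nth_traject h (n := p)) // => /eqP.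
by rewrite nth_uniq ?size_traject // => /eqP/val_inj.
Qed.

Lemma one_cycle_prime_group h : h \in C -> one_cycle p h = (h != 1%g).
Proof.
move=> Ch; have [-> | nh1] := eqVneq h 1%g; first by rewrite one_cycle1 ?prime_gt1.
rewrite -[X in one_cycle X h]card_ord; apply/one_cycle_fullP.
by exists (Ordinal (prime_gt0 p_pr)); apply: porbit_prime_group.
Qed.

End PrimeOrder.

(** * Character sums over the one-cycle elements of a wreath product *)

Section WreathSums.

Variables (p n : nat) (G : {group 'S_n}) (C : {group 'S_p}).

Lemma wreathE :
  wreath G C = (fun hg => wr hg.2 hg.1) @: setX C [set g | g \in ffun_on (mem G)].
Proof.
apply/setP=> s; apply/imset2P/imsetP=> [[g h Gg Ch ->] | [[h g]]].
  by exists (h, g); rewrite // !inE Ch; apply: Gg.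
by rewrite !inE => /andP[/= Ch Gg] ->; exists g h.
Qed.

Hypothesis n_gt0 : (0 < n)%N.

Lemma wr_pair_inj : injective (fun hg : 'S_p * {ffun 'I_p -> 'S_n} => wr hg.2 hg.1).
Proof. by move=> [h g] [h' g'] /(wr_inj n_gt0)[/= -> ->]. Qed.

Lemma card_wreath : #|wreath G C| = (#|C| * #|G| ^ p)%N.
Proof.
rewrite wreathE card_imset; last exact: wr_pair_inj.
by rewrite cardsX cardsE card_ffun_on card_ord.
Qed.

Lemma sum_wreath (Q : pred 'S_(p * n)) (F : 'S_(p * n) -> algC) :
  \sum_(x in wreath G C | Q x) F x =
  \sum_(h in C) \sum_(g : {ffun 'I_p -> 'S_n} | (g \in ffun_on (mem G)) && Q (wr g h))
     F (wr g h).
Proof.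
rewrite big_mkcondr wreathE big_imset /=; last by move=> x y _ _ /wr_pair_inj.
rewrite (eq_bigr (fun h => \sum_(g : {ffun 'I_p -> 'S_n} | g \in ffun_on (mem G))
  (if Q (wr g h) then F (wr g h) else 0))) => [|h _]; last by rewrite -big_mkcondr.
by rewrite pair_big /=; apply: eq_bigl => -[h g]; rewrite !inE.
Qed.

Variable phi : 'CF(G).
Hypothesis lin_phi : phi \is a linear_char.

Lemma sum_one_cycle_base q : (1 < q)%N ->
  \sum_(g : {ffun 'I_p -> 'S_n} | (g \in ffun_on (mem G)) && one_cycle q (wr g 1))
    \prod_i phi (g i) = p%:R * \sum_(x in G | one_cycle q x) phi x.
Proof.
move=> q_gt1.
pose A i (g : {ffun 'I_p -> 'S_n}) :=
  one_cycle q (g i) && [forall j, (j != i) ==> (g j == 1%g)].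
(* Here [1 < q] matters: the identity is not a cycle of length [q], so the nontrivial component is
   unique. *)
have A_inj g i j : A i g -> A j g -> i = j.
  move=> /andP[_ /forall_inP g1] /andP[oq _]; apply/eqP; apply: contraTT oq => nij.
  by rewrite (eqP (g1 j _)) ?one_cycle1 // eq_sym.
(* By this uniqueness the existential condition on [i] can be replaced by a sum over [i], which is
   then exchanged with the sum over [g]. *)
transitivity (\sum_(g : {ffun 'I_p -> 'S_n} | g \in ffun_on (mem G))
                \sum_(i | A i g) \prod_j phi (g j)).
  rewrite big_mkcondr; apply: eq_bigr => g _; rewrite one_cycle_wr1.
  case: existsP => [[i Ai] | nA]; last first.
    by rewrite [RHS]big_pred0 // => i; apply/negP=> Ai; case: nA; exists i.
  rewrite [RHS](big_pred1 i) // => j; apply/idP/eqP=> [Aj | -> //]; exact: A_inj Aj Ai.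
rewrite (exchange_big_dep predT) //= mulr_natl -[in RHS](card_ord p) -sumr_const.
apply: eq_big => // i _.
pose E x : {ffun 'I_p -> 'S_n} := [ffun j => if j == i then x else 1%g].
rewrite (reindex_onto E (fun g => g i)) => [|g /andP[_ /andP[_ /forall_inP g1]]]; last first.
  by apply/ffunP=> j; rewrite ffunE; case: eqVneq => [-> // | /g1/eqP->].
apply: eq_big => x.
  rewrite ffunE !eqxx andbT; congr (_ && _).
    apply/ffun_onP/idP=> [/(_ i) | Gx j]; rewrite ffunE ?eqxx //.
    by case: ifP.
  rewrite /A ffunE eqxx andb_idr // => _; apply/forall_inP=> j nji.
  by rewrite ffunE (negPf nji).
move=> _; rewrite (bigD1 i) //= ffunE eqxx big1 ?mulr1 // => j nji.
by rewrite ffunE (negPf nji) lin_char1.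
Qed.

Hypotheses (p_pr : prime p) (oC : #|C| = p).
Variable psi : 'CF(C).
Hypothesis lin_psi : psi \is a linear_char.

(** The recursion behind the induction: the first summand comes from [h = 1], the second from
    [h != 1]. *)
Lemma sum_one_cycle_wr q : (1 < q)%N ->
  \sum_(x in wreath G C | one_cycle q x) wr_char phi psi x =
    p%:R * \sum_(x in G | one_cycle q x) phi x
    + (q == p * n)%N%:R * (p%:R * (psi == 1)%:R - 1)
      * (#|G|%:R ^+ p.-1 * \sum_(x in G | one_cycle n x) phi x).
Proof.
move=> q_gt1; have p_gt1 := prime_gt1 p_pr.
have i0 : 'I_p := Ordinal (ltnW p_gt1).
rewrite sum_wreath (bigD1 1%g) //=; congr (_ + _).
  rewrite -sum_one_cycle_base //; apply: eq_bigr => g /andP[/ffun_onP Gg _].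
  by rewrite wr_charE // (lin_char1 lin_psi) mulr1.
rewrite -[in X in X * _ - 1]oC -(sum_lin_char_neq1 lin_psi).
rewrite mulr_sumr mulr_suml; apply: eq_bigr => h /andP[Ch nh1].
(* The averaging lemma is read backwards: the right side becomes a sum over all [g] of a function of
   the product along the [h]-orbit of [i0], to be compared term by term. *)
rewrite [X in _ * (_ * X)]big_mkcondr -(sum_ffun_on_prod _ _ (ltnW p_gt1)
  (expg_prime_group_inj p_pr oC (a := i0) Ch nh1)).
rewrite mulr_sumr big_mkcondr; apply: eq_bigr => g /ffun_onP Gg.
rewrite (one_cycle_wr_transitive _ _ i0 p_gt1) ?(order_prime_group p_pr oC Ch) //; last first.
  by move=> a; apply: porbit_prime_group oC _ _ _ _.
case: (q == _); last by rewrite /= !mul0r.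
rewrite mul1r /=; case: ifP => _; last by rewrite mulr0.
(* A linear character ignores the order of the factors, and the exponents [t < p] run through every
   block once. *)
rewrite wr_charE // mulrC (lin_char_prod lin_phi) //; congr (_ * _).
by rewrite (reindex_inj (expg_prime_group_inj p_pr oC (a := i0) Ch nh1)).
Qed.

End WreathSums.

(** * Group orders and the constants *)

Lemma card_sylS p (C : {group 'S_p}) k :
  #|C| = p -> #|sylS C k| = (p ^ \sum_(i < k) p ^ i)%N.
Proof.
move=> oC; have p_gt0 : (0 < p)%N by rewrite -oC cardG_gt0.
elim: k => [|[|k] IHk]; first by rewrite big_ord0 cards1.
  by rewrite big_ord1; apply: oC.
rewrite [LHS](card_wreath (sylS C k.+1)) ?expn_gt0 ?p_gt0 // IHk oC -expnM -expnS.
rewrite [in RHS]big_ord_recl expn0 add1n; congr (p ^ _.+1)%N; rewrite big_distrl /=.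
by apply: eq_bigr => i _; rewrite -expnSr.
Qed.

Section Constants.

Variables (p k : nat) (u : {ffun 'I_k.+1 -> bool}).
Let u' := [ffun i => u (widen_ord (leqnSn k) i)].

Lemma Cconst_widen l : (l <= k)%N -> Cconst p l u = Cconst p l u'.
Proof.
move=> le_lk; congr (_ * _).
rewrite big_mkcond big_ord_recr /= ltnNge le_lk mulr1 -big_mkcond.
by apply: eq_bigr => i _; rewrite ffunE.
Qed.

(** Matches the [h != 1] summand of the recursion: the power of p with the sum as exponent is the
    order of the level-k group raised to p - 1. That exponent is p^k - 1, while the exponent in
    [Cconst] grows by p^k - 2 and the outer power by 1. *)
Lemma Cconst_top : (1 < p)%N ->
  p%:R ^+ k.+1 * Cconst p k.+1 u =
  (p%:R * (u ord_max)%:R - 1)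
    * (p%:R ^+ (\sum_(i < k) p ^ i * p.-1)%N * (p%:R ^+ k * Cconst p k u')).
Proof.
move=> p_gt1; have p_gt0 := ltnW p_gt1.
have p_neq0 : p%:R != 0 :> algC by rewrite pnatr_eq0 -lt0n.
have quotE l : ((p ^ l - 1) %/ (p - 1))%N = (\sum_(i < l) p ^ i)%N.
  by rewrite !subn1 predn_exp mulKn // -subn1 subn_gt0.
have sumE : (\sum_(i < k) p ^ i * p.-1)%N = (p ^ k).-1.
  by rewrite predn_exp mulnC big_distrl.
have prodE : \prod_(i < k.+1 | (i < k.+1)%N) (p%:R * (u i)%:R - 1) =
    (p%:R * (u ord_max)%:R - 1)
      * \prod_(i < k | (i < k)%N) (p%:R * (u' i)%:R - 1) :> algC.
  rewrite big_mkcond big_ord_recr /= ltnSn mulrC; congr (_ * _).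
  rewrite [RHS]big_mkcond; apply: eq_bigr => i _.
  by rewrite ffunE /= ltn_ord ltnW // ltnS ltn_ord.
rewrite /Cconst prodE sumE !quotE big_ord_recr /=.
rewrite !mulrA [_ * (p%:R * _ - 1)]mulrC -!mulrA; congr (_ * _).
rewrite !mulrA; congr (_ * _).
rewrite !exprnP -!expfzDr //; congr (_ ^ _).
(* Positivity makes the truncated predecessor of p^k a true subtraction. *)
have : (0 < p ^ k)%N by rewrite expn_gt0 p_gt0.
by lia.
Qed.

End Constants.

(** * The induction on k *)

Lemma Gamma_sylX (p : nat) (C : {group 'S_p}) (k l : nat) (psi : 'I_k -> 'CF(C)) :
  prime p -> #|C| = p -> (forall i, psi i \is a linear_char) -> (0 < l <= k)%N ->
  Gamma l (sylX psi) = p%:R ^+ k * Cconst p l [ffun i => psi i == 1].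
Proof.
move=> p_pr oC; have p_gt1 := prime_gt1 p_pr; have p_gt0 := ltnW p_gt1.
elim: k l psi => [|[|k] IHk] l psi lin_psi /andP[l_gt0 le_lk].
- by rewrite leqNgt l_gt0 in le_lk.
- have {le_lk l_gt0}-> : l = 1%N by apply/eqP; rewrite eqn_leq le_lk.
  (* The case k = 1: the constant with l = 0 is 1, so what remains is the sum of the character over
     the nontrivial elements of [C], which are exactly its p-cycles. *)
  rewrite Cconst_top // big_ord0 expr0 !mul1r /Cconst expn0 subnn div0n subr0 expr0z.
  rewrite big_ord0 !mulr1 ffunE.
  rewrite -[in X in X * _ - 1]oC [ord_max]ord1 -(sum_lin_char_neq1 (lin_psi ord0)).
  apply: eq_bigl => x; apply: (@andb_id2l (x \in C)) => Cx.
  exact: (one_cycle_prime_group p_pr oC Cx).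
pose psi' i := psi (widen_ord (leqnSn k.+1) i).
have lin_psi' i : psi' i \is a linear_char by apply: lin_psi.
have lin_phi : sylX psi' \is a linear_char by apply: sylX_lin.
have n_gt0 : (0 < p ^ k.+1)%N by rewrite expn_gt0 p_gt0.
have q_gt1 : (1 < p ^ l)%N by rewrite -[1%N](expn0 p) ltn_exp2l.
rewrite [LHS](sum_one_cycle_wr n_gt0 lin_phi p_pr oC (lin_psi ord_max) q_gt1).
rewrite -expnS eqn_exp2l //.
(* For smaller [l] only the base elements contribute; for [l = k.+2] the cycle is too long to fit in
   one block, so only the elements with [h != 1] do. *)
have [el | nl] := eqVneq l k.+2; last first.
  have {}le_lk : (l <= k.+1)%N by rewrite -ltnS ltn_neqAle nl.
  rewrite !mul0r addr0 -/(Gamma l (sylX psi')) IHk ?l_gt0 //.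
  rewrite [in RHS]Cconst_widen // mulrA -exprS; congr (_ * Cconst _ _ _).
  by apply/ffunP=> i; rewrite !ffunE.
rewrite big_pred0 => [|x]; last first.
  apply/negP=> /andP[_ /one_cycle_le].
  by rewrite card_ord el leq_exp2l // ltnn.
rewrite mulr0 add0r mul1r el Cconst_top // ffunE -natrX card_sylS //.
rewrite -expnM natrX big_distrl; congr (_ * (_ * _)).
rewrite -/(Gamma k.+1 (sylX psi')) IHk ?leqnn //; congr (_ * Cconst _ _ _).
by apply/ffunP=> i; rewrite !ffunE.
Qed.

Theorem lemma4p4 (p : nat) (C : {group 'S_p}) (k l : nat)
    (u : {ffun 'I_k -> bool}) (phi : 'CF(sylS C k)) :
  prime p -> cyclic C -> #|C| = p ->
  (0 < l <= k)%N ->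
  has_shape u phi ->
  Gamma l phi = p%:R ^+ k * Cconst p l u.
Proof.
move=> p_pr _ oC lk [psi [lin_psi uE ->]]; rewrite Gamma_sylX //.
congr (_ * Cconst _ _ _); apply/ffunP=> i; rewrite ffunE.
by apply/eqP/idP => /uE.
Qed.
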